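(* Let $(R,\mathfrak m)$ be a Cohen-Macaulay local ring with $\dim R=1$. Let $I,J\in\mathcal X_R$ and suppose that $I\subsetneq J$. Choose $b\in J$ so that $J^2=bJ$. Then the following assertions hold true. (1) $J=(b)+I$. (2) $\mu_R(J)=\mu_R(I)$. (3) There exists an element $c\in\mathfrak m$ such that $I=bcA$, so that $(bc)$ is a reduction of $I$, where $A=I:I$.
   Context: Local rings are Noetherian. $\mathrm{Q}(R)$ denotes the total ring of fractions of $R$. For $R$-submodules $X,Y$ of $\mathrm{Q}(R)$, $X:Y=\{x\in \mathrm{Q}(R)\mid xY\subseteq X\}$. An $\mathfrak m$-primary ideal $I$ of $R$ is called an Ulrich ideal if it contains a parameter ideal $Q=(a)$ of $R$ as a reduction and satisfies: (1) $I\neq Q$, (2) $I^2=QI$, and (3) $I/I^2$ is a free $R/I$-module. $\mathcal X_R$ denotes the set of all Ulrich ideals of $R$. $\mu_R( * )$ denotes the number of elements in a minimal system of generators. *)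

(* Defs.v *)
From HB Require Import structures.
From mathcomp Require Import all_boot all_order all_algebra.
From mathcomp Require Import generic_quotient.
From mathcomp Require Import boolp classical_sets.
From mathcomp Require Import ring.

Set Implicit Arguments.
Unset Strict Implicit.
Unset Printing Implicit Defensive.

Import GRing.Theory.
Local Open Scope ring_scope.
Local Open Scope classical_set_scope.

(* Rings are commutative with 1 != 0; ideals are Prop-valued sets.  MathComp's
   [idealr_closed] is not used since it excludes the unit ideal. *)

Section Ideals.
Variable R : comNzRingType.
Implicit Types (I J M P Q S : set R) (s : seq R).

Definition is_ideal I : Prop :=
  [/\ I 0, (forall x y, I x -> I y -> I (x + y))
    & (forall a x, I x -> I (a * x))].

Definition ideal_gen S : set R := smallest is_ideal S.

Definition principal (a : R) : set R := ideal_gen [set a].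

Definition ideal_add I J : set R := [set x + y | x in I & y in J].

Definition ideal_mul I J : set R := ideal_gen [set x * y | x in I & y in J].

Definition ideal_exp I (n : nat) : set R := iter n (ideal_mul I) setT.

Definition radical I : set R := [set x | exists n : nat, I (x ^+ n)].

Definition prime_ideal P : Prop :=
  [/\ is_ideal P, P <> setT & forall x y, P (x * y) -> P x \/ P y].

Definition maximal_ideal M : Prop :=
  [/\ is_ideal M, M <> setT
    & forall I, is_ideal I -> M `<=` I -> I = M \/ I = setT].

Definition primary_ideal I : Prop :=
  [/\ is_ideal I, I <> setT
    & forall x y, I (x * y) -> I x \/ radical I y].

Definition primary_to M I : Prop := primary_ideal I /\ radical I = M.

Definition noetherian : Prop :=
  forall I, is_ideal I -> exists s, I = ideal_gen [set` s].

Definition local_ring M : Prop :=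
  [/\ noetherian, maximal_ideal M & forall N, maximal_ideal N -> N = M].

(* P 0 < P 1 < ... < P n *)
Definition prime_chain (n : nat) : Prop :=
  exists P : nat -> set R,
    (forall i, (i <= n)%N -> prime_ideal (P i)) /\
    (forall i, (i < n)%N -> P i `<` P i.+1).

Definition krull_dim (n : nat) : Prop := prime_chain n /\ ~ prime_chain n.+1.

(* The clause R / (s) != 0 of a regular sequence is automatic here, the
   sequence being required to lie in the proper ideal M. *)
Definition regular_seq M s : Prop :=
  (forall x, x \in s -> M x) /\
  forall i, (i < size s)%N -> forall x,
    ideal_gen [set` take i s] (s`_i * x) -> ideal_gen [set` take i s] x.

Definition depth M (n : nat) : Prop :=
  (exists2 s, regular_seq M s & size s = n) /\
  ~ (exists2 s, regular_seq M s & size s = n.+1).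

Definition cohen_macaulay M : Prop :=
  exists2 d : nat, krull_dim d & depth M d.

Definition minimal_generators I s : Prop :=
  [/\ uniq s, ideal_gen [set` s] = I
    & forall t : seq R, {subset t <= s} -> ideal_gen [set` t] = I ->
        {subset s <= t}].

(* Over a local ring all minimal systems of generators of a finitely generated
   ideal have the same cardinality (Nakayama), so the choice is immaterial. *)
Definition mu I : nat :=
  xget 0%N [set n | exists2 s, minimal_generators I s & size s = n].

Definition reduction_of Q I : Prop :=
  Q `<=` I /\
  exists n : nat, ideal_exp I n.+1 = ideal_mul Q (ideal_exp I n).

(* I / I^2 is a free R / I-module: B is a set of representatives in I of a
   basis.  Taking s duplicate-free in the independence clause also forces
   distinct elements of B to have distinct classes when I is proper. *)
Definition conormal_free I : Prop :=
  exists B : set R,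
    [/\ B `<=` I,
        (forall x, I x -> exists s (a : R -> R),
           [set` s] `<=` B /\ ideal_mul I I (x - \sum_(y <- s) a y * y))
      & (forall s (a : R -> R), uniq s -> [set` s] `<=` B ->
           ideal_mul I I (\sum_(y <- s) a y * y) ->
           forall y, y \in s -> I (a y))].

(* Stated for rings of dimension one, where a parameter ideal is a principal
   ideal that is primary to the maximal ideal. *)
Definition ulrich_ideal M I : Prop :=
  primary_to M I /\
  exists a : R,
    let Q := principal a in
    [/\ primary_to M Q, reduction_of Q I, I <> Q,
        ideal_mul I I = ideal_mul Q I & conormal_free I].

End Ideals.

(* The total ring of fractions: the localization of R at its nonzerodivisors,
   built as a quotient of pairs (numerator, nonzerodivisor), along the lines of
   mathcomp.algebra.fraction, which is limited to integral domains. *)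

Section TotalFractions.
Local Open Scope quotient_scope.
Variable R : comNzRingType.

Definition nonzerodiv : pred R := fun x => `[< GRing.lreg x >].

Lemma nonzerodivP x : reflect (GRing.lreg x) (nonzerodiv x).
Proof. exact: asboolP. Qed.

Lemma nonzerodiv1 : nonzerodiv 1.
Proof. exact/nonzerodivP/lreg1. Qed.

Lemma nonzerodivM x y : nonzerodiv x -> nonzerodiv y -> nonzerodiv (x * y).
Proof.
by move=> /nonzerodivP rx /nonzerodivP ry; apply/nonzerodivP/lregM.
Qed.

Record tratio := TRatio { tnumden :> R * R; tdenP : nonzerodiv tnumden.2 }.

HB.instance Definition _ := [isSub for tnumden].
HB.instance Definition _ := [Choice of tratio by <:].

Implicit Types x y z : tratio.

Definition mk_tratio (n d : R) (hd : nonzerodiv d) : tratio :=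
  @TRatio (n, d) hd.

Definition tequiv x y : bool := x.1 * y.2 == y.1 * x.2.

Lemma tequiv_refl : reflexive tequiv.
Proof. by move=> x; apply: eqxx. Qed.

Lemma tequiv_sym : symmetric tequiv.
Proof. by move=> x y; rewrite /tequiv eq_sym. Qed.

Lemma tequiv_trans : transitive tequiv.
Proof.
move=> y x z; rewrite /tequiv => /eqP xy /eqP yz; apply/eqP.
have /nonzerodivP := tdenP y; apply.
by rewrite mulrA [y.2 * _]mulrC xy mulrAC yz mulrAC mulrC mulrA.
Qed.

Canonical tequiv_equiv := EquivRel tequiv tequiv_refl tequiv_sym tequiv_trans.

Definition total_frac := {eq_quot tequiv}.

HB.instance Definition _ : EqQuotient _ tequiv total_frac :=
  EqQuotient.on total_frac.
HB.instance Definition _ := Choice.on total_frac.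

Lemma tequiv_repr x :
  (repr (\pi_total_frac x)).1 * x.2 = x.1 * (repr (\pi_total_frac x)).2.
Proof.
have : repr (\pi_total_frac x) = x %[mod total_frac] by rewrite reprK.
by move/eqmodP/eqP.
Qed.

Definition tfrac (n d : R) (hd : nonzerodiv d) : total_frac :=
  \pi_total_frac (mk_tratio n hd).

Definition taddr x y : tratio :=
  mk_tratio (x.1 * y.2 + y.1 * x.2) (nonzerodivM (tdenP x) (tdenP y)).
Definition toppr x : tratio := mk_tratio (- x.1) (tdenP x).
Definition tmulr x y : tratio :=
  mk_tratio (x.1 * y.1) (nonzerodivM (tdenP x) (tdenP y)).

Definition tadd := lift_op2 total_frac taddr.
Definition topp := lift_op1 total_frac toppr.
Definition tmul := lift_op2 total_frac tmulr.
Definition to_total_frac (r : R) : total_frac := tfrac r nonzerodiv1.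

Lemma pi_tadd : {morph \pi_total_frac : x y / taddr x y >-> tadd x y}.
Proof.
move=> x y; unlock tadd; apply/eqmodP; rewrite /= /tequiv /=; apply/eqP.
have ex := tequiv_repr x; have ey := tequiv_repr y.
move: (repr _) (repr _) ex ey => y' x' ex ey.
rewrite !mulrDl; congr (_ + _).
  by rewrite mulrACA -ex [y.2 * _]mulrC mulrACA.
by rewrite [x'.2 * _]mulrC mulrACA -ey [x.2 * x'.2]mulrC mulrACA
  [y.2 * _]mulrC.
Qed.
Canonical pi_tadd_morph := PiMorph2 pi_tadd.

Lemma pi_topp : {morph \pi_total_frac : x / toppr x >-> topp x}.
Proof.
move=> x; unlock topp; apply/eqmodP; rewrite /= /tequiv /=.
by rewrite !mulNr tequiv_repr.
Qed.
Canonical pi_topp_morph := PiMorph1 pi_topp.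

Lemma pi_tmul : {morph \pi_total_frac : x y / tmulr x y >-> tmul x y}.
Proof.
move=> x y; unlock tmul; apply/eqmodP; rewrite /= /tequiv /=.
by rewrite mulrACA -!tequiv_repr mulrACA.
Qed.
Canonical pi_tmul_morph := PiMorph2 pi_tmul.

Lemma total_fracW (P : total_frac -> Prop) :
  (forall x : tratio, P (\pi_total_frac x)) -> forall q, P q.
Proof. by move=> H; elim/quotW. Qed.

Lemma pi_tratio_eq x y : x.1 * y.2 = y.1 * x.2 ->
  \pi_total_frac x = \pi_total_frac y.
Proof. by move=> e; apply/eqmodP/eqP. Qed.

Lemma taddA : associative tadd.
Proof.
elim/total_fracW=> x; elim/total_fracW=> y; elim/total_fracW=> z.
by rewrite -!pi_tadd; apply: pi_tratio_eq => /=; ring.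
Qed.

Lemma taddC : commutative tadd.
Proof.
elim/total_fracW=> x; elim/total_fracW=> y.
by rewrite -!pi_tadd; apply: pi_tratio_eq => /=; rewrite addrC [x.2 * _]mulrC.
Qed.

Lemma tadd0 : left_id (to_total_frac 0) tadd.
Proof.
elim/total_fracW=> x; rewrite -pi_tadd; apply: pi_tratio_eq => /=.
by rewrite mul0r add0r mulr1 mul1r.
Qed.

Lemma taddN : left_inverse (to_total_frac 0) topp tadd.
Proof.
elim/total_fracW=> x; rewrite -pi_topp -pi_tadd; apply: pi_tratio_eq => /=.
by rewrite mulNr addNr !mul0r.
Qed.

HB.instance Definition _ :=
  GRing.isZmodule.Build total_frac taddA taddC tadd0 taddN.

Lemma tmulA : associative tmul.
Proof.
elim/total_fracW=> x; elim/total_fracW=> y; elim/total_fracW=> z.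
by rewrite -!pi_tmul; apply: pi_tratio_eq => /=; rewrite !mulrA.
Qed.

Lemma tmulC : commutative tmul.
Proof.
elim/total_fracW=> x; elim/total_fracW=> y; rewrite -!pi_tmul.
by apply: pi_tratio_eq => /=; rewrite [x.1 * _]mulrC [x.2 * _]mulrC.
Qed.

Lemma tmul1 : left_id (to_total_frac 1) tmul.
Proof.
elim/total_fracW=> x; rewrite -pi_tmul; apply: pi_tratio_eq => /=.
by rewrite !mul1r.
Qed.

Lemma tmulDl : left_distributive tmul tadd.
Proof.
elim/total_fracW=> x; elim/total_fracW=> y; elim/total_fracW=> z.
by rewrite -pi_tadd -!pi_tmul -pi_tadd; apply: pi_tratio_eq => /=; ring.
Qed.

Lemma to_total_frac_inj : injective to_total_frac.
Proof. by move=> r s /eqmodP /eqP /=; rewrite !mulr1. Qed.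

Lemma tone_neq0 : to_total_frac 1 != to_total_frac 0.
Proof. by rewrite (inj_eq to_total_frac_inj) oner_eq0. Qed.

HB.instance Definition _ := GRing.Zmodule_isComNzRing.Build total_frac
  tmulA tmulC tmul1 tmulDl tone_neq0.

Lemma to_total_frac_is_zmod_morphism : zmod_morphism to_total_frac.
Proof.
move=> r s; rewrite -[X in _ = _ + X]pi_topp -[RHS]pi_tadd.
by apply: pi_tratio_eq; rewrite /= !mulr1.
Qed.

HB.instance Definition _ :=
  GRing.isZmodMorphism.Build R total_frac to_total_frac
    to_total_frac_is_zmod_morphism.

Lemma to_total_frac_is_monoid_morphism : monoid_morphism to_total_frac.
Proof.
split=> [//|r s]; rewrite -[RHS]pi_tmul.
by apply: pi_tratio_eq; rewrite /= !mulr1.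
Qed.

HB.instance Definition _ :=
  GRing.isMonoidMorphism.Build R total_frac to_total_frac
    to_total_frac_is_monoid_morphism.

Lemma to_total_frac_unit (d : R) : nonzerodiv d ->
  exists u : total_frac, to_total_frac d * u = 1.
Proof.
move=> hd; exists (tfrac 1 hd); rewrite -[LHS]pi_tmul.
by apply: pi_tratio_eq; rewrite /= !mulr1 !mul1r.
Qed.

Lemma total_fracP (q : total_frac) :
  exists n d : R, nonzerodiv d /\ q * to_total_frac d = to_total_frac n.
Proof.
elim/total_fracW: q => x; exists x.1, x.2; split; first exact: tdenP.
by rewrite -[LHS]pi_tmul; apply: pi_tratio_eq; rewrite /= !mulr1.
Qed.

End TotalFractions.

Arguments total_frac R%_type.
Arguments to_total_frac {R} r.

Definition colon (R : comNzRingType) (X Y : set (total_frac R)) :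
    set (total_frac R) :=
  [set q | forall y, Y y -> X (q * y)].

(* Main.v *)
Require Import Defs.
From mathcomp Require Import all_boot all_order all_algebra.
From mathcomp Require Import boolp classical_sets.
From mathcomp Require Import ring.

Set Implicit Arguments.
Unset Strict Implicit.
Unset Printing Implicit Defensive.

Import GRing.Theory.
Local Open Scope ring_scope.
Local Open Scope classical_set_scope.

(** Write [A = I : I] and [B = J : J] in the total ring of fractions.  If [I^2 = aI]
    with [a] a nonzerodivisor in [I], then [A = I / a], and freeness of [I / I^2]
    together with [I <> (a)] makes [A / R = I / (a)] a nonzero free [R / I]-module,
    say of rank [r]; in the same way [B = J / b] and [B / R = J / (b)] is free
    over [R / J], say of rank [s].  Hence [mu I = r + 1] and [mu J = s + 1].
    Since [I] annihilates [A / R] exactly, [(a) : I = I], from which [B] lies in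
    [A], that is, [J I] lies in [bI] (lemma [mulJI]).  All the arguments below are
    carried out inside [R], after multiplication by [a] or [b].

    Assertion (1).  The inclusion of [B] in [A] gives [J A = b A], so that [J] and
    [b] have the same multiples in [A / R], a nonzero free [R / I]-module; hence [J]
    and [(b)] agree modulo [I] (lemma [ulrich_pair_add]).

    Assertions (2) and (3).  Let [K = I : b], which is [I : J] by (1).  An element
    of [A] lies in [B] if and only if [J] multiplies it into [R], so that [B / R] is
    the submodule of the elements of [A / R], a power of [R / I], that [J]
    annihilates: it is [K / I] to the power [r].  This shows two things.

    - [I^2 = aI] is contained in [bKI] (lemmas [mulJa_basis] and [sq_generated]).
      So [bK] is not contained in [mI], for otherwise Nakayama's lemma would give
      [I^2 = 0].  Take [c] in [K] with [bc] outside [mI].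
    - [s] is at least [r] times the dimension of [K / (I + mK)]
      (lemma [card_mul_basis_le]).

    On the other hand [J = (b) + I] identifies [J / (b)] with [I / (I :&: (b))], and
    [bc], a minimal generator of [I], becomes zero there, so that [s <= r] (lemma
    [basis_le]).  Therefore [s = r], which is (2), and [K = (c) + I + mK].  Then
    [I^2] is contained in [bcI + mI^2], and Nakayama's lemma gives [I^2 = bcI], which
    is [I = bcA].  The element [c] is not a unit, since [b] is not in [I].

    Counting takes place in vector spaces over the residue field, which is not
    formed: independence is always meant modulo [m], and the bounds come from an
    elimination over the local ring (lemmas [row_relation] and
    [independent_le]). *)

(** * Ideals of a commutative ring *)

Section IdealTheory.
Variable R : comNzRingType.
Implicit Types (I J M N : set R) (a b x y : R).

Lemma is_ideal_mulr I a x : is_ideal I -> I x -> I (x * a).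
Proof. by case=> _ _ mulI Ix; rewrite mulrC; apply: mulI. Qed.

Lemma idealB I x y : is_ideal I -> I x -> I y -> I (x - y).
Proof.
by case=> _ addI mulI Ix Iy; apply: addI => //; rewrite -mulN1r; apply: mulI.
Qed.

Lemma ideal_sum (T : finType) I (F : T -> R) :
  is_ideal I -> (forall t, I (F t)) -> I (\sum_t F t).
Proof.
move=> [I0 addI _] IF.
by elim/big_ind: _ => // x y; apply: addI.
Qed.

Lemma ideal_addK I x y : is_ideal I -> I (x + y) -> I y -> I x.
Proof. by move=> idI Ixy Iy; rewrite -(addrK y x); apply: idealB. Qed.

Lemma zero_ideal : is_ideal [set (0 : R)].
Proof. by split=> [//|x y -> ->|c x ->] /=; rewrite ?addr0 ?mulr0. Qed.

Lemma ideal_gen_ideal S : is_ideal (@ideal_gen R S).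
Proof.
split=> [M [[]]//|x y Sx Sy M SM|a x Sx M SM].
  by case: (SM) => -[_ addM _] _; apply: addM; [apply: Sx | apply: Sy].
by case: (SM) => -[_ _ mulM] _; apply: mulM; apply: Sx.
Qed.

Lemma mem_ideal_gen (S : set R) : S `<=` ideal_gen S.
Proof. by move=> x Sx M [_]; apply. Qed.

Lemma ideal_gen_min (S : set R) I : is_ideal I -> S `<=` I -> ideal_gen S `<=` I.
Proof. by move=> idI SI x; apply. Qed.

Lemma principalP a x : principal a x <-> exists r, x = r * a.
Proof.
split=> [|[r ->]].
  apply: (@ideal_gen_min _ [set x | exists r, x = r * a]) => [|_ ->]; last first.
    by exists 1; rewrite mul1r.
  split=> [|_ _ [r ->] [s ->]|c _ [r ->]]; first by exists 0; rewrite mul0r.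
    by exists (r + s); rewrite mulrDl.
  by exists (c * r); rewrite mulrA.
by have [_ _] := ideal_gen_ideal [set a]; apply; apply: mem_ideal_gen.
Qed.

Lemma ideal_add_ideal I J : is_ideal I -> is_ideal J -> is_ideal (ideal_add I J).
Proof.
move=> [I0 addI mulI] [J0 addJ mulJ]; split.
- by exists 0 => //; exists 0 => //; rewrite addr0.
- move=> _ _ [x Ix [y Jy <-]] [x' Ix' [y' Jy' <-]].
  exists (x + x'); first exact: addI.
  by exists (y + y'); [exact: addJ | rewrite addrACA].
- move=> a _ [x Ix [y Jy <-]]; exists (a * x); first exact: mulI.
  by exists (a * y); [exact: mulJ | rewrite mulrDr].
Qed.

Lemma sub_ideal_addl I J : J 0 -> I `<=` ideal_add I J.
Proof. by move=> J0 x Ix; exists x => //; exists 0 => //; rewrite addr0. Qed.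

Lemma sub_ideal_addr I J : I 0 -> J `<=` ideal_add I J.
Proof. by move=> I0 x Jx; exists 0 => //; exists x => //; rewrite add0r. Qed.

Lemma ideal_mul_ideal I J : is_ideal (ideal_mul I J).
Proof. exact: ideal_gen_ideal. Qed.

Lemma mem_ideal_mul I J x y : I x -> J y -> ideal_mul I J (x * y).
Proof. by move=> Ix Jy; apply: mem_ideal_gen; exists x => //; exists y. Qed.

Lemma ideal_mul_min I J M :
  is_ideal M -> (forall x y, I x -> J y -> M (x * y)) -> ideal_mul I J `<=` M.
Proof.
move=> idM IJM; apply: ideal_gen_min => // _ [x Ix [y Jy <-]]; exact: IJM.
Qed.

Lemma ideal_mulT I : is_ideal I -> ideal_mul I setT = I.
Proof.
move=> idI; apply/seteqP; split=> [|x Ix].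
  by apply: ideal_mul_min => // x y Ix _; apply: is_ideal_mulr.
by rewrite -(mulr1 x); apply: mem_ideal_mul.
Qed.

Lemma image_mul_ideal a I : is_ideal I -> is_ideal [set a * x | x in I].
Proof.
move=> [I0 addI mulI]; split; first by exists 0; rewrite ?mulr0.
  by move=> _ _ [x Ix <-] [y Iy <-]; exists (x + y); [exact: addI | rewrite mulrDr].
by move=> c _ [x Ix <-]; exists (c * x); [exact: mulI | rewrite mulrCA].
Qed.

Lemma principal_mul a I : is_ideal I ->
  ideal_mul (principal a) I = [set a * x | x in I].
Proof.
move=> idI; have [_ _ mulI] := idI; apply/seteqP; split.
  apply: ideal_mul_min => [|_ y /principalP[c ->] Iy]; first exact: image_mul_ideal.
  by exists (c * y); [exact: mulI | rewrite mulrCA mulrA].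
by move=> _ [x Ix <-]; apply: mem_ideal_mul => //; apply: mem_ideal_gen.
Qed.

Lemma reduction_mul a I x y : ideal_mul I I = [set a * x | x in I] ->
  I x -> I y -> exists2 z, I z & x * y = a * z.
Proof.
move=> sqI Ix Iy; have := mem_ideal_mul Ix Iy; rewrite sqI => -[z Iz <-].
by exists z.
Qed.

(** A coefficient is attached to each position of the list, not to each value,
    so that repeated generators do no harm. *)
Lemma ideal_gen_seqP (s : seq R) x :
  ideal_gen [set` s] x <-> exists c : nat -> R, x = \sum_(i < size s) c i * s`_i.
Proof.
split=> [|[c ->]]; last first.
  have idS := ideal_gen_ideal [set` s].
  apply: ideal_sum => // i; case: (idS) => _ _; apply.
  by apply: mem_ideal_gen; rewrite /= mem_nth.
apply: (@ideal_gen_min _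
  [set x | exists c : nat -> R, x = \sum_(i < size s) c i * s`_i]).
  split.
  - by exists (fun=> 0); rewrite big1 // => i _; rewrite mul0r.
  - move=> _ _ [c ->] [d ->]; exists (fun i => c i + d i).
    by rewrite -big_split; apply: eq_bigr => i _; rewrite mulrDl.
  - move=> a _ [c ->]; exists (fun i => a * c i).
    by rewrite mulr_sumr; apply: eq_bigr => i _; rewrite mulrA.
move=> y /= ys; have lt_i : (index y s < size s)%N by rewrite index_mem.
exists (fun i => (i == index y s)%:R).
rewrite (bigD1 (Ordinal lt_i)) //= eqxx mul1r nth_index // big1 ?addr0 // => i ne_i.
suff /negPf->: val i != index y s by rewrite mul0r.
by apply: contra ne_i => /eqP e; apply/eqP/val_inj.
Qed.

End IdealTheory.

(** * Nakayama's lemma and independence modulo the maximal ideal *)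

Section LocalRing.
Variables (R : comNzRingType) (m : set R).
Hypothesis Rlocal : local_ring m.
Implicit Types (I J M N : set R) (a b x y : R).

Let m_ideal : is_ideal m. Proof. by case: Rlocal => _ []. Qed.

Lemma local_not1 : ~ m 1.
Proof.
move=> m1; case: Rlocal => _ [_ neT _] _; apply: neT.
by apply/seteqP; split=> // x _; rewrite -(mulr1 x); case: m_ideal => _ _; apply.
Qed.

(** Otherwise Zorn's lemma puts [x] in some maximal ideal, and [m] is the only
    one.  The empty set is admitted in the inductive family so that the empty
    chain has an upper bound. *)
Lemma local_unit x : ~ m x -> exists d, d * x = 1.
Proof.
move=> mx; apply: contrapT => nunit; apply: mx.
pose P := [set M : set R | M = set0 \/ [/\ is_ideal M, ~ M 1 & M x]].
have idx := ideal_gen_ideal [set x].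
have Px : P (principal x).
  right; split=> //; last by apply: mem_ideal_gen.
  by move=> /principalP[d dx]; apply: nunit; exists d.
have idP A y : P A -> A y -> [/\ is_ideal A, ~ A 1 & A x] by case=> [->|].
have [F FP Ftot|M [PM Mmax]] := @Zorn_bigcup R P.
  have [->|/set0P[y [A FA Ay]]] := eqVneq (\bigcup_(X in F) X) set0; first by left.
  have [[A0 _ _] _ Ax] := idP _ _ (FP _ FA) Ay.
  right; split; [split|move=> [B FB B1]|by exists A].
  - by exists A.
  - move=> u v [B FB Bu] [C FC Cv].
    have [[_ addB _] _ _] := idP _ _ (FP _ FB) Bu.
    have [[_ addC _] _ _] := idP _ _ (FP _ FC) Cv.
    have [BC|CB] := Ftot _ _ FB FC; [exists C | exists B] => //.
      by apply: addC => //; apply: BC.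
    by apply: addB => //; apply: CB.
  - move=> c u [B FB Bu]; exists B => //.
    by have [[_ _ mulB] _ _] := idP _ _ (FP _ FB) Bu; apply: mulB.
  - by have [_ nB1 _] := idP _ _ (FP _ FB) B1.
have [idM nM1 Mx] : [/\ is_ideal M, ~ M 1 & M x].
  case: (PM) => // M0; case: (Mmax _ _ Px); split; rewrite M0 ?sub0set // => sx0.
  exact: (sx0 x (mem_ideal_gen _)).
case: Rlocal => _ _ /(_ M) <- //; split=> // [MT|I idI MI].
  by apply: nM1; rewrite MT.
have [I1|nI1] := pselect (I 1).
  by right; apply/seteqP; split=> // y _; rewrite -(mul1r y); apply: is_ideal_mulr.
left; apply/seteqP; split=> //; apply: contrapT => IM.
by apply: (Mmax I) => //; right; split=> //; apply: MI.
Qed.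

Lemma local_1subr_unit x : m x -> exists d, d * (1 - x) = 1.
Proof.
move=> mx; apply: local_unit => m1x; apply: local_not1.
by rewrite -(subrK x 1); case: m_ideal => _ addm _; apply: addm.
Qed.


(** Solving the last congruence for the last generator, whose coefficient
    [1 - c] is a unit, removes it from the others. *)
Lemma nakayama_seq N n (f : nat -> R) : is_ideal N ->
  (forall k, (k < n)%N -> exists2 c : nat -> R, (forall i, m (c i)) &
     N (f k - \sum_(i < n) c i * f i)) ->
  forall k, (k < n)%N -> N (f k).
Proof.
move=> idN; have [N0 addN mulN] := idN; have [m0 addm mulm] := m_ideal.
elim: n => [|n IHn] H k //.
have [cn mcn] := H n (ltnSn n); rewrite big_ord_recr /= => Nn.
have [d ud] := local_1subr_unit (mcn n).
have Nn' : N (f n - \sum_(i < n) d * cn i * f i).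
  have := mulN d _ Nn; congr N.
  under [in RHS]eq_bigr => i _ do rewrite -mulrA.
  rewrite -mulr_sumr -[X in _ = X - _]mul1r -ud; ring.
have sub j : (j < n)%N -> N (f j).
  apply: IHn => l ltl; have [c mc] := H l (ltnW ltl).
  rewrite big_ord_recr /= => Nl.
  exists (fun i => c i + c n * (d * cn i)).
    by move=> i; apply: addm => //; exact/mulm/mulm.
  have := addN _ _ Nl (mulN (c n) _ Nn'); congr N.
  under [in RHS]eq_bigr => i _ do rewrite mulrDl -mulrA.
  rewrite big_split -mulr_sumr /=; ring.
rewrite ltnS leq_eqVlt => /orP[/eqP->|/sub//].
rewrite -(subrK (\sum_(i < n) d * cn i * f i) (f n)); apply: addN => //.
by apply: ideal_sum => // i; apply: mulN; apply: sub.
Qed.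

Lemma nakayama N M : is_ideal N -> is_ideal M ->
  M `<=` ideal_add N (ideal_mul m M) -> M `<=` N.
Proof.
move=> idN idM MNmM; have [N0 addN mulN] := idN.
have [noeth _ _] := Rlocal; have [s Ms] := noeth M idM.
have mMP x : ideal_mul m M x -> exists2 c : nat -> R, (forall i, m (c i)) &
    x = \sum_(i < size s) c i * s`_i.
  pose D := [set x | exists2 c : nat -> R, (forall i, m (c i)) &
    x = \sum_(i < size s) c i * s`_i].
  have [m0 addm mulm] := m_ideal.
  apply: (@ideal_mul_min _ _ _ D) => [|u v mu]; last first.
    rewrite Ms => /ideal_gen_seqP[c ->]; exists (fun i => c i * u).
      by move=> i; apply: mulm.
    by rewrite mulr_sumr; apply: eq_bigr => i _; rewrite mulrCA mulrA.
  split.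
  - by exists (fun=> 0) => //; rewrite big1 // => i _; rewrite mul0r.
  - move=> _ _ [c mc ->] [e me ->]; exists (fun i => c i + e i).
      by move=> i; apply: addm.
    by rewrite -big_split; apply: eq_bigr => i _; rewrite mulrDl.
  - move=> a _ [c mc ->]; exists (fun i => a * c i).
      by move=> i; apply: mulm.
    by rewrite mulr_sumr; apply: eq_bigr => i _; rewrite mulrA.
have sN k : (k < size s)%N -> N s`_k.
  apply: nakayama_seq => // l lts.
  have Ml : M s`_l by rewrite Ms; apply: mem_ideal_gen; rewrite /= mem_nth.
  have [x Nx [y /mMP[c mc ->] <-]] := MNmM _ Ml.
  by exists c => //; rewrite addrK.
move=> x; rewrite Ms => /ideal_gen_seqP[c ->].
by apply: ideal_sum => // i; apply: mulN; apply: sN.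
Qed.

(** Gaussian elimination over the residue field, without forming it: a matrix
    with more rows than columns has a row relation modulo [m] that is
    nontrivial there. *)
Lemma row_relation (T : finType) p (A : {set T}) (c : nat -> T -> R) :
  (p < #|A|)%N ->
  exists u : T -> R, [/\ exists2 t, t \in A & ~ m (u t),
    forall t, t \notin A -> u t = 0 &
    forall j, (j < p)%N -> m (\sum_t u t * c j t)].
Proof.
have [m0 addm mulm] := m_ideal.
elim: p A c => [|p IHp] A c ltpA.
  have /card_gt0P[t At] := ltpA; exists (fun s => (s == t)%:R); split=> //.
    by exists t => //; rewrite eqxx; apply: local_not1.
  by move=> s; case: eqP => // ->; rewrite At.
have [all_m|] := pselect (forall t, t \in A -> m (c p t)).
  have [u [nzu supu mu]] := IHp A c (ltnW ltpA); exists u; split=> // j.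
  rewrite ltnS leq_eqVlt => /orP[/eqP->|/mu//].
  apply: ideal_sum => // t; have [At|/supu->] := boolP (t \in A).
    by apply: mulm; apply: all_m.
  by rewrite mul0r.
move=> /existsNP[t0 /not_implyP[At0 /local_unit[d ud]]].
have ltp : (p < #|A :\ t0|)%N by move: ltpA; rewrite (cardsD1 t0) At0.
pose c' j t := c j t - c p t * d * c j t0.
have [u [[t1 At1 nzu] supu mu]] := IHp _ c' ltp.
have ut0 : u t0 = 0 by apply: supu; rewrite !inE eqxx.
pose s := \sum_t u t * c p t * d.
exists (fun t => u t - (t == t0)%:R * s).
have sumE j : \sum_t (u t - (t == t0)%:R * s) * c j t
            = \sum_t u t * c' j t.
  rewrite (eq_bigr (fun t => u t * c j t - (t == t0)%:R * (s * c j t))); last first.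
    by move=> t _; ring.
  rewrite sumrB (bigD1 t0 (P := predT)) //= [X in _ - X](bigD1 t0) //= eqxx mul1r.
  rewrite [X in _ - (_ + X)]big1 => [|t /negPf->]; last by rewrite mul0r.
  rewrite addr0 -(bigD1 t0 (P := predT) (F := fun t => u t * c j t)) //=.
  rewrite /s mulr_suml -sumrB; apply: eq_bigr => t _; rewrite /c'; ring.
split.
- move: At1; rewrite !inE => /andP[/negPf ne At1]; exists t1 => //.
  by rewrite ne mul0r subr0.
- move=> t nAt; have /negPf-> : t != t0 by apply: contraNneq nAt => ->.
  by rewrite supu ?mul0r ?subr0 // !inE negb_and nAt orbT.
- move=> j; rewrite ltnS leq_eqVlt sumE => /orP[/eqP->|/mu//].
  rewrite big1 // => t _; rewrite /c' -mulrA [d * _]ud; ring.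
Qed.

(** Steinitz' bound.  Since [N] contains the products of [m] with the [y j], these
    span modulo [N] a vector space over the residue field. *)
Lemma independent_le (T : finType) p (x : T -> R) (y : 'I_p -> R) N :
  is_ideal N -> (forall z j, m z -> N (z * y j)) ->
  (forall t, exists c : 'I_p -> R, N (x t - \sum_j c j * y j)) ->
  (forall u : T -> R, N (\sum_t u t * x t) -> forall t, m (u t)) ->
  (#|T| <= p)%N.
Proof.
move=> idN Nmy span indep; rewrite leqNgt; apply/negP => ltp.
have [N0 addN mulN] := idN.
have /choice[c cP] := span.
pose c' j t := if insub j is Some j' then c t j' else 0.
rewrite -cardsT in ltp.
have [u [[t _ nzu] _ mu]] := row_relation c' ltp.
apply/nzu/indep; rewrite -(subrK (\sum_t u t * \sum_j c t j * y j) (\sum_t _)).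
apply: addN; first rewrite -sumrB.
  by apply: ideal_sum => // s; rewrite -mulrBr; apply: mulN.
under eq_bigr => s _ do rewrite mulr_sumr.
rewrite exchange_big /=; apply: ideal_sum => // j.
under eq_bigr => s _ do rewrite mulrA.
rewrite -mulr_suml; apply: Nmy; have := mu j (ltn_ord j); congr m.
by apply: eq_bigr => s _; rewrite /c' valK.
Qed.

End LocalRing.

(** * Minimal systems of generators *)

Lemma sum_pred1 (R : comNzRingType) (T : finType) (k : T) (f : T -> R) :
  \sum_t (t == k)%:R * f t = f k.
Proof.
rewrite (bigD1 k) //= eqxx mul1r big1 ?addr0 // => t /negPf->.
by rewrite mul0r.
Qed.

Definition cons_family (T : Type) r (x : T) (f : 'I_r -> T) (i : 'I_r.+1) : T :=
  if unlift ord0 i is Some j then f j else x.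

Lemma sum_cons_family (R : comNzRingType) r (x : R) (f : 'I_r -> R) z :
  \sum_i z i * cons_family x f i = z ord0 * x + \sum_i z (lift ord0 i) * f i.
Proof.
rewrite big_ord_recl /cons_family unlift_none; congr (_ + _).
by apply: eq_bigr => i _; rewrite liftK.
Qed.

Lemma sum_cons_family2 (R : comNzRingType) r (c x : R) (z f : 'I_r -> R) :
  \sum_i cons_family c z i * cons_family x f i = c * x + \sum_i z i * f i.
Proof.
rewrite sum_cons_family /cons_family unlift_none; congr (_ + _).
by apply: eq_bigr => i _; rewrite liftK.
Qed.

Section MinimalGenerators.
Variables (R : comNzRingType) (m : set R).
Hypothesis Rlocal : local_ring m.
Implicit Types (I J M N : set R) (a b x y : R).

Let m_ideal : is_ideal m. Proof. by case: Rlocal => _ []. Qed.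

(** If the coefficient of a generator is a unit, Nakayama's lemma shows that the
    other generators generate [I]. *)
Lemma minimal_generators_independent I (t : seq R) (u : nat -> R) :
  is_ideal I -> minimal_generators I t ->
  ideal_mul m I (\sum_(i < size t) u i * t`_i) ->
  forall i, (i < size t)%N -> m (u i).
Proof.
move=> idI [uniq_t gent mint] mIu k ltk; apply: contrapT => /(local_unit Rlocal).
move=> [d ud]; set s := rem t`_k t.
have sub_st : {subset s <= t} by move=> y; apply: mem_rem.
suff Is : ideal_gen [set` s] = I.
  by have := mint s sub_st Is t`_k (mem_nth 0 ltk); rewrite mem_rem_uniq // inE eqxx.
have ids := ideal_gen_ideal [set` s].
apply/seteqP; split.
  by apply: ideal_gen_min => // y /sub_st ty; rewrite -gent; apply: mem_ideal_gen.
apply: (nakayama Rlocal) => //; set N := ideal_add _ _.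
have idN : is_ideal N by apply: ideal_add_ideal => //; apply: ideal_mul_ideal.
have [_ _ mulN] := idN.
have sN y : y \in s -> N y.
  move=> sy; apply: sub_ideal_addl; last exact: mem_ideal_gen.
  by case: (ideal_mul_ideal m I).
rewrite -{1}gent; apply: ideal_gen_min => // y /= ty.
have [->|ne_yk] := eqVneq y t`_k; last first.
  by apply: sN; rewrite mem_rem_uniq // inE ne_yk.
rewrite -(mul1r t`_k) -ud -mulrA; apply: (mulN).
have Nsum : N (\sum_(i < size t) u i * t`_i).
  by apply: sub_ideal_addr => //; case: ids.
move: Nsum; rewrite (bigD1 (Ordinal ltk)) //= => /ideal_addK; apply=> //.
rewrite big_mkcond; apply: ideal_sum => // i; case: ifP => [ne_ik|_]; last first.
  by case: idN.
apply/mulN/sN; rewrite mem_rem_uniq // inE mem_nth // andbT.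
by rewrite nth_uniq.
Qed.

(** Nakayama's lemma turns a basis of [I / mI] into a minimal system of
    generators, and conversely, so that [mu I] is the dimension of [I / mI]. *)
Lemma mu_independent I n (f : 'I_n -> R) :
  is_ideal I -> (forall i, I (f i)) ->
  (forall x, I x -> exists z : 'I_n -> R, x = \sum_i z i * f i) ->
  (forall z : 'I_n -> R, ideal_mul m I (\sum_i z i * f i) -> forall i, m (z i)) ->
  mu I = n.
Proof.
move=> idI If span indep; have [I0 addI mulI] := idI.
have idmI := ideal_mul_ideal m I; have [mI0 _ _] := idmI.
have inj_f : injective f.
  move=> i j eq_f; apply/eqP/negP => /negP ne_ij; apply: (local_not1 Rlocal).
  have := indep (fun k => (k == i)%:R - (k == j)%:R) _ i.
  rewrite eqxx (negPf ne_ij) subr0; apply.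
  under eq_bigr => k _ do rewrite mulrBl.
  by rewrite sumrB !sum_pred1 eq_f subrr.
apply: xget_unique => [|_ [t mint <-]].
  exists (codom f); last by rewrite size_codom card_ord.
  have memf i : f i \in codom f by apply: codom_f.
  split; first by rewrite map_inj_uniq ?enum_uniq.
    apply/seteqP; split; first by apply: ideal_gen_min => // _ /codomP[i ->].
    move=> x /span[z ->]; apply: ideal_sum => [|i]; first exact: ideal_gen_ideal.
    have [_ _ mulS] := ideal_gen_ideal [set` codom f].
    by apply: mulS; apply: mem_ideal_gen; exact: memf.
  move=> t sub_t gent _ /codomP[i ->]; apply/negP => /negP nfi.
  pose D := [set x | exists2 z : 'I_n -> R, z i = 0 & x = \sum_j z j * f j].
  have: D (f i).
    have : ideal_gen [set` t] (f i) by rewrite gent.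
    apply: ideal_gen_min => [|y /= ty].
      split.
      - by exists (fun=> 0) => //; rewrite big1 // => j _; rewrite mul0r.
      - move=> _ _ [z z0 ->] [w w0 ->]; exists (fun j => z j + w j).
          by rewrite z0 w0 addr0.
        by rewrite -big_split; apply: eq_bigr => j _; rewrite mulrDl.
      - move=> a _ [z z0 ->]; exists (fun j => a * z j); first by rewrite z0 mulr0.
        by rewrite mulr_sumr; apply: eq_bigr => j _; rewrite mulrA.
    have /codomP[j yj] := sub_t _ ty.
    exists (fun k => (k == j)%:R); last by rewrite sum_pred1.
    by case: eqP => // ij; rewrite ij -yj ty in nfi.
  case=> z z0 fi; apply: (local_not1 Rlocal).
  have := indep (fun j => (j == i)%:R - z j) _ i.
  rewrite eqxx z0 subr0; apply.
  under eq_bigr => k _ do rewrite mulrBl.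
  by rewrite sumrB sum_pred1 -fi subrr.
have [_ gent _] := mint.
have It (i : 'I_(size t)) : I t`_i.
  by rewrite -gent; apply: mem_ideal_gen; rewrite /= mem_nth.
apply/eqP; rewrite eqn_leq; apply/andP; split.
  rewrite -[size t]card_ord.
  apply: (independent_le Rlocal idmI (x := fun i : 'I_(size t) => t`_i) (y := f)).
  - by move=> z j mz; apply: mem_ideal_mul.
  - by move=> i; have [z ->] := span _ (It i); exists z; rewrite subrr.
  - move=> u mu_ i; pose u' k := if insub k is Some k' then u k' else 0.
    have := @minimal_generators_independent I t u' idI mint _ i (ltn_ord i).
    rewrite /u' valK; apply; move: mu_; congr (ideal_mul _ _ _).
    by apply: eq_bigr => k _; rewrite valK.
rewrite -[n]card_ord.
apply: (independent_le Rlocal idmI (x := f)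
         (y := fun i : 'I_(size t) => t`_i)) => //.
  by move=> z j mz; apply: mem_ideal_mul.
move=> i; have : ideal_gen [set` t] (f i) by rewrite gent.
move=> /ideal_gen_seqP[c ->].
by exists c; rewrite subrr.
Qed.

End MinimalGenerators.

(** * Bases of [I / I^2] and of [I / (a)] *)

(** [I / (a)] is free over [R / I] with the classes of the [e i] as a basis. *)
Definition quotient_basis (R : comNzRingType) (I : set R) (a : R) r
    (e : 'I_r -> R) : Prop :=
  [/\ forall i, I (e i),
      forall x, I x -> exists c (z : 'I_r -> R), x = c * a + \sum_i z i * e i
    & forall (z : 'I_r -> R) c, \sum_i z i * e i = c * a -> forall i, I (z i)].

Section UlrichBasis.
Variables (R : comNzRingType) (m : set R).
Hypothesis Rlocal : local_ring m.
Implicit Types (I J M N : set R) (a b x y : R).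

Let m_ideal : is_ideal m. Proof. by case: Rlocal => _ []. Qed.

(** The members of the basis that occur in expansions of finitely many generators
    of [I] span [I / I^2]. *)
Lemma conormal_free_finite I : is_ideal I -> conormal_free I ->
  exists n (e : 'I_n -> R),
    [/\ forall i, I (e i),
        forall x, I x ->
          exists z : 'I_n -> R, ideal_mul I I (x - \sum_i z i * e i)
      & forall z : 'I_n -> R, ideal_mul I I (\sum_i z i * e i) ->
          forall i, I (z i)].
Proof.
move=> idI [B [BI span indep]].
have [noeth _ _] := Rlocal; have [t It] := noeth I idI.
have idII := ideal_mul_ideal I I; have [II0 _ _] := idII.
pose gen2 (s : seq R) := ideal_add (ideal_gen [set` s]) (ideal_mul I I).
have idg s : is_ideal (gen2 s).
  by apply: ideal_add_ideal => //; apply: ideal_gen_ideal.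
have gen2S s s' : {subset s <= s'} -> gen2 s `<=` gen2 s'.
  move=> ss' _ [x sx [y IIy <-]]; exists x; last by exists y.
  move: sx; apply: ideal_gen_min; first exact: ideal_gen_ideal.
  by move=> z /ss' s'z; apply: mem_ideal_gen.
have [s [us sB ts]] : exists s : seq R,
    [/\ uniq s, [set` s] `<=` B & forall x, x \in t -> gen2 s x].
  have: forall x, x \in t -> I x by move=> x tx; rewrite It; apply: mem_ideal_gen.
  elim: t {It} => [|x t IHt] tI; first by exists [::].
  have [|s [_ sB ts]] := IHt; first by move=> y ty; apply: tI; rewrite inE ty orbT.
  have [s' [c [s'B xs']]] := span x (tI x (mem_head _ _)).
  exists (undup (s' ++ s)); split; first exact: undup_uniq.
    by move=> y; rewrite /= mem_undup mem_cat => /orP[/s'B|/sB].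
  move=> y; rewrite inE => /orP[/eqP->|/ts]; last first.
    by apply: gen2S => z sz; rewrite mem_undup mem_cat sz orbT.
  apply: (@gen2S s') => [z s'z|]; first by rewrite mem_undup mem_cat s'z.
  exists (\sum_(y <- s') c y * y); last first.
    by exists (x - \sum_(y <- s') c y * y); rewrite // addrC subrK.
  have [g0 addg mulg] := ideal_gen_ideal [set` s'].
  by rewrite big_seq; elim/big_ind: _ => // z s'z; apply: mulg; apply: mem_ideal_gen.
exists (size s), (fun i => s`_i); split=> [i|x Ix|z IIz i].
- by apply/BI/sB; rewrite /= mem_nth.
- have : gen2 s x by have := Ix; rewrite {1}It; apply: ideal_gen_min.
  case=> _ /ideal_gen_seqP[c ->] [y IIy <-]; exists c.
  by rewrite addrC addKr.
- pose c y := if insub (index y s) is Some j then z j else 0.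
  have cE (j : 'I_(size s)) : c s`_j = z j by rewrite /c index_uniq // valK.
  rewrite -cE; apply: (indep s) => //; last exact: mem_nth.
  rewrite (big_nth 0) big_mkord; move: IIz; congr (ideal_mul _ _ _).
  by apply: eq_bigr => j _; rewrite cE.
Qed.

Lemma ideal_mul3 I M J x y :
  ideal_mul I M x -> J y -> ideal_mul I (ideal_mul M J) (x * y).
Proof.
move=> IMx Jy; move: x IMx.
have [D0 addD mulD] := ideal_mul_ideal I (ideal_mul M J).
apply: (@ideal_mul_min _ _ _ [set x | ideal_mul I (ideal_mul M J) (x * y)]).
  split=> [|u v Du Dv|c u Du] /=; first by rewrite mul0r.
    by rewrite mulrDl; apply: addD.
  by rewrite -mulrA; apply: mulD.
by move=> u v Iu Mv /=; rewrite -mulrA; do 2!apply: mem_ideal_mul => //.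
Qed.

(** If [I^2 = aI] with [a] in [mI], then [I^2 = m I^2], and Nakayama's lemma
    gives [a^2 = 0]. *)
Lemma reduction_notin_mI I a : GRing.lreg a -> I a ->
  ideal_mul I I = [set a * x | x in I] ->
  ~ ideal_mul m I a.
Proof.
move=> rega Ia sqI mIa.
have id0 := zero_ideal R.
have II0 : ideal_mul I I `<=` [set (0 : R)].
  apply: (nakayama Rlocal) => //; first exact: ideal_mul_ideal.
  have idD : is_ideal (ideal_add [set 0] (ideal_mul m (ideal_mul I I))).
    by apply: ideal_add_ideal => //; apply: ideal_mul_ideal.
  apply: ideal_mul_min => // x y Ix Iy; have [z Iz ->] := reduction_mul sqI Ix Iy.
  by apply: sub_ideal_addr => //; apply: ideal_mul3.
have /= aa0 := II0 _ (mem_ideal_mul Ia Ia).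
have a0 : a = 0 by apply: rega; rewrite aa0 mulr0.
have /eqP := oner_neq0 R; apply; apply: rega.
by rewrite a0 !mul0r.
Qed.

(** Since [a] is not in [mI], it is part of a basis of [I / I^2], which
    is exchanged for one with [a] as a member.  The other members are the
    basis sought, because [I^2] lies in [(a)]; there are some because [I] is not
    [(a)]. *)
Lemma ulrich_quotient_basis I a : is_ideal I -> I `<=` m -> conormal_free I ->
  GRing.lreg a -> I a -> I <> principal a ->
  ideal_mul I I = [set a * x | x in I] ->
  exists r (e : 'I_r.+1 -> R), quotient_basis I a e.
Proof.
move=> idI Im freeI rega Ia neIa sqI; have [I0 addI mulI] := idI.
have [n [e [Ie span indep]]] := conormal_free_finite idI freeI.
have [c IIc] := span a Ia.
have [k /(local_unit Rlocal)[d ud]] : exists k, ~ m (c k).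
  apply: contrapT => /forallNP all_m; apply: (reduction_notin_mI rega Ia sqI).
  rewrite -(subrK (\sum_i c i * e i) a).
  have idmI := ideal_mul_ideal m I; case: (idmI) => _ addmI _; apply: addmI.
    by move: IIc; apply: ideal_mul_min => // x y /Im mx Iy; apply: mem_ideal_mul.
  apply: ideal_sum => // i; apply: mem_ideal_mul => //.
  by apply: contrapT; apply: all_m.
case: n => [|n] in e Ie span indep c IIc k ud *; first by case: (k).
have [w Iw /esym aE] : [set a * x | x in I] (a - \sum_i c i * e i) by rewrite -sqI.
have sumE (z : 'I_n.+1 -> R) : \sum_i z i * e i =
    z k * e k + \sum_i z (lift k i) * e (lift k i) by rewrite (bigD1_ord k).
have spank x : I x -> exists c (z : 'I_n -> R), x = c * a + \sum_i z i * e (lift k i).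
  move=> Ix; have [z] := span x Ix; rewrite sqI => -[v Iv /esym xE].
  exists (v + z k * d * (1 - w)), (fun i => z (lift k i) - z k * d * c (lift k i)).
  under eq_bigr => i _ do rewrite mulrBl -(mulrA (z k * d)).
  rewrite sumrB -mulr_sumr.
  move/eqP: xE; rewrite subr_eq sumE => /eqP->.
  have := aE; rewrite sumE => aE'.
  set S := \sum_i z _ * _; set S' := \sum_i c _ * _ in aE' *.
  have ekE : e k = d * (a - a * w - S').
    rewrite -aE'; transitivity (d * c k * e k); [by rewrite ud mul1r | ring].
  rewrite ekE; ring.
have indepk (z : 'I_n -> R) x :
    \sum_i z i * e (lift k i) = x * a -> forall i, I (z i).
  move=> zE.
  pose z' j := (if unlift k j is Some i then z i else 0) - x * c j.
  have Iz' : forall j, I (z' j).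
    apply: indep; rewrite /z'; under eq_bigr => j _ do rewrite mulrBl -mulrA.
    rewrite sumrB -mulr_sumr (bigD1_ord k) //= unlift_none mul0r add0r.
    under eq_bigr => j _ do rewrite liftK.
    rewrite zE -mulrBr; have [_ _ mulII] := ideal_mul_ideal I I.
    exact: mulII.
  have Ix : I x.
    rewrite -(mul1r x) -ud -mulrA; apply: (mulI); rewrite mulrC.
    have := mulI (-1) _ (Iz' k); rewrite /z' unlift_none.
    by rewrite sub0r mulN1r opprK.
  move=> i; have := Iz' (lift k i); rewrite /z' liftK => Izi.
  apply: (ideal_addK idI Izi).
  by rewrite -mulNr; apply: is_ideal_mulr => //; rewrite -mulN1r; apply: mulI.
case: n => [|n] in e k Ie c sumE spank indepk IIc ud aE {span indep} *.
  case: neIa; apply/seteqP; split.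
    move=> x /spank[x' [z ->]]; rewrite big_ord0 addr0; apply/principalP.
    by exists x'.
  by move=> x /principalP[x' ->]; apply: mulI.
by exists n, (fun i => e (lift k i)); split.
Qed.

Section QuotientBasis.
Variables (I : set R) (a : R) (r : nat) (e : 'I_r -> R).
Hypotheses (idI : is_ideal I) (Im : I `<=` m) (Ia : I a).
Hypothesis basis_e : quotient_basis I a e.

Lemma mem_mI_basis x : ideal_mul m I x ->
  exists c (z : 'I_r -> R),
    [/\ m c, forall i, m (z i) & x = c * a + \sum_i z i * e i].
Proof.
have [m0 addm mulm] := m_ideal; have [_ span _] := basis_e.
pose D := [set x | exists c (z : 'I_r -> R),
    [/\ m c, forall i, m (z i) & x = c * a + \sum_i z i * e i]].
move: x; apply: (@ideal_mul_min _ _ _ D).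
  split.
  - exists 0, (fun=> 0); split=> //; rewrite mul0r big1 ?addr0 // => i _.
    by rewrite mul0r.
  - move=> _ _ [c [z [mc mz ->]]] [c' [z' [mc' mz' ->]]].
    exists (c + c'), (fun i => z i + z' i); split=> [|i|]; [exact: addm | exact: addm |].
    under [in RHS]eq_bigr => i _ do rewrite mulrDl.
    by rewrite big_split /=; ring.
  - move=> y _ [c [z [mc mz ->]]].
    exists (y * c), (fun i => y * z i); split=> [|i|]; [exact: mulm | exact: mulm |].
    under [in RHS]eq_bigr => i _ do rewrite -mulrA.
    by rewrite -mulr_sumr; ring.
move=> x y mx /span[c [z ->]]; exists (x * c), (fun i => x * z i).
split=> [|i|]; [exact: (is_ideal_mulr _ m_ideal) | exact: (is_ideal_mulr _ m_ideal) |].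
under [in RHS]eq_bigr => i _ do rewrite -mulrA.
by rewrite -mulr_sumr; ring.
Qed.

Lemma quotient_basis_independent (z : 'I_r -> R) :
  ideal_add (principal a) (ideal_mul m I) (\sum_i z i * e i) ->
  forall i, m (z i).
Proof.
have [_ _ indep] := basis_e; have [m0 addm mulm] := m_ideal.
case=> _ /principalP[x ->] [y /mem_mI_basis[c [w [mc mw ->]]] sumE] i.
have Iz : I (z i - w i).
  apply: (indep (fun j => z j - w j) (x + c)).
  by under eq_bigr => j _ do rewrite mulrBl; rewrite sumrB -sumE; ring.
by rewrite -(subrK (w i) (z i)); apply: addm => //; apply: Im.
Qed.

Lemma mu_quotient_basis : ~ ideal_mul m I a -> mu I = r.+1.
Proof.
move=> nmIa; have [Ie span indep] := basis_e.
have idmI := ideal_mul_ideal m I; have [_ addmI mulmI] := idmI.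
apply: (mu_independent Rlocal (f := cons_family a e)) => //.
- by move=> i; rewrite /cons_family; case: unliftP.
- move=> x /span[c [z ->]].
  by exists (cons_family c z); rewrite sum_cons_family2.
- move=> z; rewrite sum_cons_family => mIz.
  have mzS j : m (z (lift ord0 j)).
    apply: (quotient_basis_independent (z := fun j => z (lift ord0 j))).
    exists (- z ord0 * a); first by apply/principalP; exists (- z ord0).
    by exists (z ord0 * a + \sum_i z (lift ord0 i) * e i) => //; ring.
  have mIza : ideal_mul m I (z ord0 * a).
    apply: (ideal_addK idmI mIz); apply: ideal_sum => // i.
    exact: mem_ideal_mul.
  move=> i; case: (unliftP ord0 i) => [j ->|->] //.
  apply: contrapT => /(local_unit Rlocal)[d ud]; apply: nmIa.
  by rewrite -(mul1r a) -ud -mulrA; apply: mulmI.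
Qed.

End QuotientBasis.
End UlrichBasis.

(** * Two Ulrich ideals, one inside the other *)

Section UlrichPair.
Variables (R : comNzRingType) (m I J : set R) (a b : R).
Variables (r s : nat) (e : 'I_r.+1 -> R) (g : 'I_s -> R).
Hypotheses (Rlocal : local_ring m).
Hypotheses (idI : is_ideal I) (idJ : is_ideal J) (Jm : J `<=` m).
Hypotheses (IJ : I `<=` J) (JnI : ~ (J `<=` I)).
Hypotheses (rega : GRing.lreg a) (regb : GRing.lreg b) (Ia : I a) (Jb : J b).
Hypothesis sqI : ideal_mul I I = [set a * x | x in I].
Hypothesis sqJ : ideal_mul J J = [set b * x | x in J].
Hypotheses (basis_e : quotient_basis I a e) (basis_g : quotient_basis J b g).
Implicit Types (x y z k : R).

Let m_ideal : is_ideal m. Proof. by case: Rlocal => _ []. Qed.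
Let Im : I `<=` m. Proof. by move=> x /IJ /Jm. Qed.

(** [(a) : I = I], since [I] annihilates the nonzero free module [I / (a)]
    exactly. *)
Lemma colon_reduction x : (forall y, I y -> exists c, x * y = c * a) -> I x.
Proof.
have [Ie _ indep] := basis_e => /(_ _ (Ie ord0))[c xe].
have := indep (fun i => (i == ord0)%:R * x) c _ ord0; rewrite eqxx mul1r; apply.
rewrite -xe -(sum_pred1 ord0 (fun i => x * e i)).
by apply: eq_bigr => i _; rewrite mulrA.
Qed.

(** This says that [J : J = J / b] is contained in [I : I]: for [j] in [J], the
    product [(j / b) I^2 = a ((j / b) I)] lies in [(a)], so that [(j / b) I] lies in
    [(a) : I]. *)
Lemma mulJI x j : I x -> J j -> exists2 y, I y & j * x = b * y.
Proof.
move=> Ix Jj; have [y Jy jx] := reduction_mul sqJ Jj (IJ Ix); exists y => //.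
apply: colon_reduction => x' Ix'; have [z Iz xx'] := reduction_mul sqI Ix Ix'.
have [w _ jz] := reduction_mul sqJ Jj (IJ Iz); exists w; apply: regb.
by rewrite mulrA -jx -mulrA xx' mulrCA jz mulrCA [w * a]mulrC.
Qed.

(** Comparing coefficients at one basis element in [J * I = b * I]. *)
Lemma ulrich_pair_add : J = ideal_add (principal b) I.
Proof.
have [_ addJ mulJ] := idJ; have [Ie span indep] := basis_e.
apply/seteqP; split=> [j Jj|_ [_ /principalP[c ->] [y Iy <-]]]; last first.
  by apply: addJ; [apply: mulJ | apply: IJ].
have [y Iy je] := mulJI (Ie ord0) Jj; have [c [z yE]] := span y Iy.
exists (z ord0 * b); first by apply/principalP; exists (z ord0).
exists (j - z ord0 * b); last by rewrite addrC subrK.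
have := indep (fun i => (i == ord0)%:R * j - z i * b) (b * c) _ ord0.
rewrite eqxx mul1r; apply.
under eq_bigr => i _ do rewrite mulrBl -!mulrA.
rewrite sumrB (sum_pred1 ord0 (fun i => j * e i)) je yE.
under [X in _ - X]eq_bigr => i _ do rewrite mulrCA.
rewrite -mulr_sumr; ring.
Qed.

(** The ideal [I : b], which equals [I : J]. *)
Let K : set R := [set k | I (b * k)].

Let K_ideal : is_ideal K.
Proof.
have [I0 addI mulI] := idI; split=> [|x y Kx Ky|c x Kx]; rewrite /K /=.
- by rewrite mulr0.
- by rewrite mulrDr; apply: addI.
- by rewrite mulrCA; apply: mulI.
Qed.

(** This expands the element [j / b] of [J : J] in the generators [1] and [e i / a]
    of [I : I].  Its product with [b] is in [R], so that the coefficients of the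
    [e i / a], which are unique modulo [I], are in [K]. *)
Lemma mulJa_basis j : J j -> exists c (k : 'I_r.+1 -> R),
  [/\ forall i, K (k i), I j -> K c & j * a = b * (c * a + \sum_i k i * e i)].
Proof.
have [_ _ mulI] := idI; have [Ie span indep] := basis_e.
move=> Jj; have [y Iy ja] := mulJI Ia Jj; have [c [k yE]] := span y Iy.
have sumE : b * (\sum_i k i * e i) = a * (j - b * c).
  by rewrite mulrBr [a * j]mulrC ja yE; ring.
have Kk i : K (k i).
  apply: (indep (fun i => b * k i) (j - b * c)).
  by under eq_bigr => l _ do rewrite -mulrA; rewrite -mulr_sumr sumE mulrC.
exists c, k; split=> // [Ij|]; last by rewrite ja yE.
have [w Iw ajE] : [set a * x | x in I] (b * (\sum_i k i * e i)).
  rewrite mulr_sumr; apply: ideal_sum => [|i]; first exact: image_mul_ideal.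
  by rewrite -sqI mulrA; apply: mem_ideal_mul => //; apply: Kk.
rewrite /K /=; suff <- : j - w = b * c by apply: idealB.
by move: ajE; rewrite sumE => /rega->; ring.
Qed.

(** All of [I^2 = aI] lies in [bKI], so that a multiple [bc] that generates
    [bK] modulo [mI] generates [I^2] over [I], by Nakayama's lemma. *)
Lemma sq_generated c : I (b * c) ->
  (forall k, K k -> ideal_add (principal (b * c)) (ideal_mul m I) (b * k)) ->
  forall x, I x -> exists2 y, I y & a * x = b * c * y.
Proof.
move=> Ibc genK x Ix; have [Ie _ _] := basis_e.
have idN := image_mul_ideal (b * c) idI.
suff sub : ideal_mul I I `<=` [set b * c * y | y in I].
  by have [y Iy <-] := sub _ (mem_ideal_mul Ia Ix); exists y.
apply: (nakayama Rlocal) => //; first exact: ideal_mul_ideal.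
set D := ideal_add _ _; have idD : is_ideal D.
  by apply: ideal_add_ideal => //; apply: ideal_mul_ideal.
have [_ addD _] := idD; have [_ _ mulI] := idI.
have KD k y : K k -> I y -> D (b * k * y).
  move=> /genK[_ /principalP[z ->] [w mIw <-]] Iy; rewrite mulrDl.
  exists (z * (b * c) * y); last by exists (w * y) => //; apply: ideal_mul3.
  by exists (z * y); [exact: mulI | ring].
rewrite sqI => _ [y Iy <-].
have [z [k [Kk Kz ya]]] := mulJa_basis (IJ Iy).
rewrite mulrC ya mulrDr; apply: (addD).
  by rewrite mulrA; apply: KD => //; apply: Kz.
rewrite mulr_sumr; apply: ideal_sum => // i.
by rewrite mulrA; apply: KD => //; apply: Kk.
Qed.

Lemma exists_generator : exists2 c, K c & ~ ideal_mul m I (b * c).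
Proof.
apply: contrapT => none.
have [||y _] := @sq_generated 0 _ _ _ Ia.
- by rewrite mulr0; case: idI.
- move=> k Kk; apply: sub_ideal_addr; first by case: (ideal_gen_ideal [set b * 0]).
  by apply: contrapT => nmI; apply: none; exists k.
- rewrite mulr0 mul0r -(mulr0 a) => /rega a0; have /eqP := oner_neq0 R; apply.
  by apply: rega; rewrite a0 !mul0r.
Qed.

(** Since [J = (b) + I], a basis of [J / (b)] lifts to [I].  Together with an element
    [bc] outside [mI] the lifts are independent in [I / mI], which [a] and the
    [e i] span. *)
Lemma basis_le : (s <= r.+1)%N.
Proof.
have [c Kc nmI] := exists_generator; have [Ig _ _] := basis_g.
have [Ie span _] := basis_e; have idmI := ideal_mul_ideal m I.
have [mI0 addmI mulmI] := idmI.
have /choice[x xP] i : exists x, I x /\ exists c, g i = c * b + x.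
  have := Ig i; rewrite {1}ulrich_pair_add => -[_ /principalP[d ->] [x Ix <-]].
  by exists x; split=> //; exists d.
rewrite -ltnS -{1}[s.+1]card_ord.
apply: (independent_le Rlocal idmI (x := cons_family (b * c) x)
         (y := cons_family a e)).
- move=> z j mz; apply: mem_ideal_mul => //.
  by rewrite /cons_family; case: unliftP.
- move=> i; have : I (cons_family (b * c) x i).
    by rewrite /cons_family; case: unliftP => [j _|_] //; case: (xP j).
  move=> /span[d [z ->]]; exists (cons_family d z).
  by rewrite sum_cons_family2 subrr.
- move=> u; rewrite sum_cons_family => mIu.
  have mu i : m (u (lift ord0 i)).
    apply: (quotient_basis_independent Rlocal Jm basis_g
              (z := fun i => u (lift ord0 i))).
    have /choice[d gE] l : exists d, g l = d * b + x l by case: (xP l).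
    exists (b * (\sum_i u (lift ord0 i) * d i - u ord0 * c)).
      apply/principalP; exists (\sum_i u (lift ord0 i) * d i - u ord0 * c).
      by rewrite mulrC.
    exists (u ord0 * (b * c) + \sum_i u (lift ord0 i) * x i).
      move: mIu; apply: ideal_mul_min => [|p q]; first exact: ideal_mul_ideal.
      by move=> mp /IJ Jq; apply: mem_ideal_mul.
    under [in RHS]eq_bigr => l _ do rewrite gE mulrDr mulrA.
    by rewrite big_split -mulr_suml /=; ring.
  have mIbc : ideal_mul m I (u ord0 * (b * c)).
    apply: (ideal_addK idmI mIu); apply: ideal_sum => // i.
    by apply: mem_ideal_mul => //; case: (xP i).
  move=> i; case: (unliftP ord0 i) => [j ->|->] //.
  apply: contrapT => /(local_unit Rlocal)[d ud]; apply: nmI.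
  by rewrite -(mul1r (b * c)) -ud -mulrA; apply: mulmI.
Qed.

Lemma mul_b_IK x : ideal_add I (ideal_mul m K) x -> ideal_mul m I (b * x).
Proof.
have [_ addmI mulmI] := ideal_mul_ideal m I.
move=> [y Iy [z mKz <-]]; rewrite mulrDr; apply: (addmI).
  by apply: mem_ideal_mul => //; apply: Jm.
move: z mKz; apply: (@ideal_mul_min _ _ _ [set z | ideal_mul m I (b * z)]).
  split=> [|u v|d u] /=; first by rewrite mulr0; case: (ideal_mul_ideal m I).
    by rewrite mulrDr; apply: addmI.
  by rewrite mulrCA; apply: mulmI.
by move=> u k mu Kk /=; rewrite mulrCA; apply: mem_ideal_mul.
Qed.

Lemma mem_mJ_basis j : ideal_mul m J j -> exists c (k : 'I_r.+1 -> R),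
  (forall i, ideal_mul m K (k i)) /\ j * a = b * (c * a + \sum_i k i * e i).
Proof.
have [mK0 addmK mulmK] := ideal_mul_ideal m K.
pose D := [set j | exists c (k : 'I_r.+1 -> R),
  (forall i, ideal_mul m K (k i)) /\ j * a = b * (c * a + \sum_i k i * e i)].
move: j; apply: (@ideal_mul_min _ _ _ D).
  split.
  - exists 0, (fun=> 0); split=> //.
    by rewrite big1 => [|i _]; rewrite ?mul0r // addr0 mulr0.
  - move=> u v [c [k [mk uE]]] [d [l [ml vE]]].
    exists (c + d), (fun i => k i + l i); split=> [i|]; first exact: addmK.
    under eq_bigr => i _ do rewrite mulrDl.
    by rewrite big_split mulrDl uE vE /=; ring.
  - move=> x u [c [k [mk uE]]].
    exists (x * c), (fun i => x * k i); split=> [i|]; first exact: mulmK.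
    under eq_bigr => i _ do rewrite -mulrA.
    by rewrite -mulr_sumr -mulrA uE; ring.
move=> x j mx /mulJa_basis[c [k [Kk _ jE]]].
exists (x * c), (fun i => x * k i); split=> [i|]; first exact: mem_ideal_mul.
under eq_bigr => i _ do rewrite -mulrA.
by rewrite -mulr_sumr -mulrA jE; ring.
Qed.

(** Multiplication by [b / a] turns the elements [c l * e i] of [I] into elements of
    [I] that are independent in [J] modulo [(b) + mJ]: up to [(b)], it identifies
    a power of [K / I], with one factor for each [e i], with [J / (b)]. *)
Lemma card_mul_basis_le (L : finType) (c : L -> R) :
  (forall l, K (c l)) ->
  (forall u : L -> R, ideal_add I (ideal_mul m K) (\sum_l u l * c l) ->
     forall l, m (u l)) ->
  (#|L| * r.+1 <= s)%N.
Proof.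
move=> Kc indep_c; have [Ie _ indep] := basis_e; have [Ig span _] := basis_g.
have /choice[w wP] (t : L * 'I_r.+1) :
    exists w, I w /\ b * c t.1 * e t.2 = a * w.
  by have [w Iw wE] := reduction_mul sqI (Kc t.1) (Ie t.2); exists w.
have idN : is_ideal (ideal_add (principal b) (ideal_mul m J)).
  by apply: ideal_add_ideal; apply: ideal_gen_ideal.
have cardT : #|{: L * 'I_r.+1}| = (#|L| * r.+1)%N by rewrite card_prod card_ord.
rewrite -cardT; apply: (independent_le Rlocal idN (x := w) (y := g)).
- move=> z j mz; apply: sub_ideal_addr; last exact: mem_ideal_mul.
  by case: (ideal_gen_ideal [set b]).
- move=> t; have [Iw _] := wP t; have [d [z ->]] := span _ (IJ Iw); exists z.
  rewrite addrK; apply: sub_ideal_addl; first by case: (ideal_mul_ideal m J).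
  by apply/principalP; exists d.
- move=> u [_ /principalP[d ->] [j /mem_mJ_basis[d' [k [mk jE]]] uE]] [l i].
  apply: (indep_c (fun l => u (l, i))).
  have Ii : I (\sum_l u (l, i) * c l - k i).
    apply: (indep (fun i => \sum_l u (l, i) * c l - k i) (d + d')); apply: regb.
    have sumE : b * (\sum_i (\sum_l u (l, i) * c l) * e i) = a * (d * b + j).
      transitivity (\sum_i \sum_l u (l, i) * (b * c l * e i)).
        rewrite mulr_sumr; apply: eq_bigr => i' _; rewrite mulr_suml mulr_sumr.
        by apply: eq_bigr => l' _; ring.
      rewrite exchange_big pair_bigA /= uE mulr_sumr; apply: eq_bigr => t _.
      by have [_ ->] := wP t; rewrite -surjective_pairing; ring.
    under eq_bigr => i' _ do rewrite mulrBl.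
    by rewrite sumrB mulrBr sumE [a * _]mulrC mulrDl jE; ring.
  by exists (\sum_l u (l, i) * c l - k i) => //; exists (k i); rewrite // subrK.
Qed.

(** Counting ranks forces [K / I] to be cyclic, so that a single [bc] generates
    [bK] modulo [mI]. *)
Lemma ulrich_pair_generator :
  s = r.+1 /\ exists c, [/\ m c, I (b * c) &
    forall x, I x -> exists2 y, I y & a * x = b * c * y].
Proof.
have [c Kc nmI] := exists_generator.
set N := ideal_add I (ideal_mul m K).
have idN : is_ideal N by apply: ideal_add_ideal => //; apply: ideal_mul_ideal.
have [N0 addN mulN] := idN; have [m0 addm mulm] := m_ideal.
have indep1 u : N (u * c) -> m u.
  move=> Nuc; apply: contrapT => /(local_unit Rlocal)[d ud]; apply: nmI.
  by apply: mul_b_IK; rewrite -(mul1r c) -ud -mulrA; apply: mulN.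
split.
  apply/eqP; rewrite eqn_leq basis_le /= -(mul1n r.+1) -card_unit.
  apply: (card_mul_basis_le (c := fun=> c)) => // u.
  by rewrite (big_pred1 tt) => [|[]//]; move=> /indep1 mu [].
exists c; split=> //.
  (* If [c] were a unit, [b] would be in [I], and then [J = (b) + I = I]. *)
  apply: contrapT => /(local_unit Rlocal)[d dc]; apply: JnI.
  have [_ addI mulI] := idI.
  rewrite ulrich_pair_add => _ [_ /principalP[x ->] [y Iy <-]]; apply: addI => //.
  apply: (mulI); rewrite -(mul1r b) -dc -mulrA [c * b]mulrC; exact: mulI.
apply: sq_generated => // k Kk; apply: contrapT => nk.
(* Otherwise [c] and [k] are independent modulo [I + mK], and [2 (r + 1) <= s]. *)
have : (#|{: bool}| * r.+1 <= s)%N; last first.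
  rewrite card_bool leqNgt => /negP; apply.
  by rewrite (leq_ltn_trans basis_le) // mul2n -addnn -{1}[r.+1]addn0 ltn_add2l.
apply: (card_mul_basis_le (c := fun l : bool => if l then c else k)) => [[]|u] //.
rewrite big_bool /= => Nck.
have mk : m (u false).
  apply: contrapT => /(local_unit Rlocal)[d ud]; apply: nk.
  exists (- (d * u true) * (b * c)).
    by apply/principalP; exists (- (d * u true)).
  exists (b * (d * (u true * c + u false * k))).
    by apply: mul_b_IK; apply: mulN.
  by rewrite -[k in RHS]mul1r -ud; ring.
have Nk : N (u false * k).
  by apply: sub_ideal_addr; [case: idI | apply: mem_ideal_mul].
by case=> //; apply: indep1; apply: (ideal_addK idN Nck).
Qed.

End UlrichPair.

(** * Parameters, and colons in the total ring of fractions *)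

Lemma lreg_mul0 (R : comNzRingType) (a : R) :
  (forall x, a * x = 0 -> x = 0) -> GRing.lreg a.
Proof.
move=> rega x y axy; apply/eqP; rewrite -subr_eq0; apply/eqP/rega.
by rewrite mulrBr axy subrr.
Qed.

Lemma lreg_dvd (R : comNzRingType) (a x y : R) :
  GRing.lreg x -> x = a * y -> GRing.lreg a.
Proof. by move=> regx xE u v auv; apply: regx; rewrite xE mulrAC auv mulrAC. Qed.

Lemma prime_chain_le (R : comNzRingType) n k :
  (k <= n)%N -> prime_chain R n -> prime_chain R k.
Proof.
move=> le_kn [P [primeP ltP]]; exists P; split=> i le_ik.
  exact: primeP (leq_trans le_ik le_kn).
exact: ltP (leq_trans le_ik le_kn).
Qed.

(** The depth being positive, [m] contains a nonzerodivisor, and a parameter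
    divides some power of it. *)
Lemma parameter_lreg (R : comNzRingType) (m : set R) (a : R) :
  krull_dim R 1 -> cohen_macaulay m -> primary_to m (principal a) ->
  GRing.lreg a.
Proof.
move=> [chain1 nchain2] [d [chaind nchaind] [[t [tm treg] sizet] _]] [_ rada].
have d_gt0 : (0 < d)%N.
  by rewrite lt0n; apply/negP => /eqP d0; apply: nchaind; rewrite d0.
have regz : GRing.lreg t`_0.
  apply: lreg_mul0 => x tx; have := treg 0; rewrite sizet d_gt0 take0.
  have gen0 : ideal_gen [set` ([::] : seq R)] `<=` [set 0].
    by apply: ideal_gen_min => //; apply: zero_ideal.
  move=> /(_ isT x); rewrite tx => regx; apply: gen0; apply: regx.
  by case: (ideal_gen_ideal [set` ([::] : seq R)]).
have : m t`_0 by apply: tm; apply: mem_nth; rewrite sizet.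
rewrite -rada => -[n /principalP[c tn]].
by apply: (@lreg_dvd _ a (t`_0 ^+ n) c); [exact: lregX | rewrite mulrC].
Qed.

(** If [J^2 = bJ] and [J = (b)], any other reduction [a] with [J^2 = aJ] is a
    unit multiple of [b]. *)
Lemma nonprincipal_reduction (R : comNzRingType) (J : set R) (a b : R) :
  is_ideal J -> GRing.lreg b -> J a -> J <> principal a ->
  ideal_mul J J = [set a * x | x in J] -> J b -> J <> principal b.
Proof.
move=> [J0 addJ mulJ] regb Ja neJa sqJ Jb Jb_eq; apply: neJa.
have [u aE] : exists u, a = u * b by apply/principalP; rewrite -Jb_eq.
have [x Jx bb] := reduction_mul sqJ Jb Jb.
have [v xE] : exists v, x = v * b by apply/principalP; rewrite -Jb_eq.
have bE : b = v * a.
  by apply: regb; rewrite bb xE; ring.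
apply/seteqP; split=> [y|y /principalP[c ->]]; last exact: mulJ.
rewrite Jb_eq => /principalP[c ->]; apply/principalP.
by exists (c * v); rewrite -mulrA -bE.
Qed.

Lemma ulrich_idealP (R : comNzRingType) (m I : set R) :
  krull_dim R 1 -> cohen_macaulay m -> ulrich_ideal m I ->
  [/\ is_ideal I, I `<=` m, conormal_free I
    & exists a, [/\ GRing.lreg a, I a, I <> principal a
                  & ideal_mul I I = [set a * x | x in I]]].
Proof.
move=> dimR RCM [[[idI _ _] radI] [a [prim_a [aI _] neIa sqI freeI]]].
split=> //; first by rewrite -radI => x Ix; exists 1%N; rewrite expr1.
exists a; split=> //; first exact: parameter_lreg prim_a.
  by apply: aI; apply: mem_ideal_gen.
by rewrite sqI principal_mul.
Qed.

(** If [I^2 = qI] then [I : I = I / q]. *)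
Lemma colon_reduction_total_frac (R : comNzRingType) (I : set R) (q : R) :
  is_ideal I -> GRing.lreg q -> I q -> ideal_mul I I = [set q * x | x in I] ->
  to_total_frac @` I =
  [set to_total_frac q * x
    | x in colon (to_total_frac @` I) (to_total_frac @` I)].
Proof.
move=> idI regq Iq sqI.
have [u qu] := to_total_frac_unit (introT (nonzerodivP q) regq).
apply/seteqP; split=> [_ [y Iy <-]|_ [x Ax <-]]; last first.
  by rewrite mulrC; apply: Ax; exists q.
exists (u * to_total_frac y); last by rewrite mulrA qu mul1r.
move=> _ [i Ii <-]; have [z Iz yi] := reduction_mul sqI Iy Ii.
by exists z; rewrite // -mulrA -rmorphM yi rmorphM mulrA [u * _]mulrC qu mul1r.
Qed.

Theorem theorem3p1 (R : comNzRingType) (m : set R)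
    (Rlocal : local_ring m) (RCM : cohen_macaulay m) (dimR : krull_dim R 1)
    (I J : set R) (UI : ulrich_ideal m I) (UJ : ulrich_ideal m J)
    (IJ : I `<` J)
    (b : R) (Jb : J b) (JJ : ideal_mul J J = [set b * x | x in J]) :
  [/\ J = ideal_add (principal b) I,
      mu J = mu I
    & exists c : R,
        let A : set (total_frac R) := colon (to_total_frac @` I) (to_total_frac @` I) in
        [/\ m c,
            to_total_frac @` I = [set to_total_frac (b * c) * x | x in A]
          & reduction_of (principal (b * c)) I]].
Proof.
have [idI Im freeI [a [rega Ia neIa sqI]]] := ulrich_idealP dimR RCM UI.
have [idJ Jm freeJ [a' [rega' Ja' neJa' sqJ']]] := ulrich_idealP dimR RCM UJ.
have [sIJ nsJI] := IJ.
have regb : GRing.lreg b.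
  have [x Jx xE] := reduction_mul JJ Ja' Ja'.
  exact: lreg_dvd (lregM rega' rega') xE.
have neJb := nonprincipal_reduction idJ regb Ja' neJa' sqJ' Jb.
have [r [e basis_e]] := ulrich_quotient_basis Rlocal idI Im freeI rega Ia neIa sqI.
have [s [g basis_g]] := ulrich_quotient_basis Rlocal idJ Jm freeJ regb Jb neJb JJ.
have JE := ulrich_pair_add idJ sIJ regb Jb sqI JJ basis_e.
have [rs [c [mc Ibc genI]]] :=
  ulrich_pair_generator Rlocal idI idJ Jm sIJ nsJI rega regb Ia Jb sqI JJ
    basis_e basis_g.
have muE (L : set R) x t (f : 'I_t -> R) : is_ideal L -> L `<=` m ->
    GRing.lreg x -> L x -> ideal_mul L L = [set x * y | y in L] ->
    quotient_basis L x f -> mu L = t.+1.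
  move=> idL Lm regx Lx sqL basis_f.
  apply: (mu_quotient_basis Rlocal idL Lm Lx basis_f).
  exact: reduction_notin_mI.
have [I0 addI mulI] := idI.
have sqI' : ideal_mul I I = [set b * c * x | x in I].
  apply/seteqP; split; first by rewrite sqI => _ [x /genI[y Iy ->] <-]; exists y.
  by move=> _ [y Iy <-]; apply: mem_ideal_mul.
have regbc : GRing.lreg (b * c).
  have [x _ xE] := genI _ Ia; exact: lreg_dvd (lregM rega rega) xE.
split=> //.
  by rewrite (muE J b _ g) // rs (muE I a _ e).
exists c => A; split=> //; first exact: colon_reduction_total_frac.
split; first by apply: ideal_gen_min => // _ ->.
by exists 1%N; rewrite /ideal_exp /= ideal_mulT // sqI' principal_mul.
Qed.
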